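(* Let $({}_{f_2}M_1\times{}_{f_1}M_2,F)$ be a doubly warped product Finsler manifold. Then the vertical distribution $VTM^\circ$ is totally geodesic if and only if $\mathbf{F}^c_{ab}=\mathbf{G}^c_{ab}$ for all $a,b,c$.
   Context: A Finsler metric on a manifold $M$ is a function $F:TM\to[0,\infty)$ that is $C^\infty$ on the slit tangent bundle $TM^\circ$, positively $1$-homogeneous on fibres, and whose fibre Hessian of $\frac12F^2$ is positive definite. Let $(M_1,F_1)$, $(M_2,F_2)$ be Finsler manifolds and let $f_1:M_1\to\mathbb{R}^+$, $f_2:M_2\to\mathbb{R}^+$ be smooth. The doubly warped product Finsler manifold $({}_{f_2}M_1\times{}_{f_1}M_2,F)$ is $M=M_1\times M_2$ with $$F(v_1,v_2)=\sqrt{f_2^2(\pi_2(v_2))F_1^2(v_1)+f_1^2(\pi_1(v_1))F_2^2(v_2)},\qquad (v_1,v_2)\in TM^\circ:=TM_1^\circ\times TM_2^\circ,$$ where $\pi_1,\pi_2$ are the base-point projections. Local induced coordinates are $(x^i,y^i)$ on $TM_1$, $(u^\alpha,v^\alpha)$ on $TM_2$, and $\mathbf{x}^a=(x^i,u^\alpha)$, $\mathbf{y}^a=(y^i,v^\alpha)$ on $TM$; repeated indices are summed. Put $\mathbf{g}_{ab}=\frac12\frac{\partial^2F^2}{\partial\mathbf{y}^a\partial\mathbf{y}^b}$ with inverse $\mathbf{g}^{ab}$, $\mathbf{G}^a=\frac14\mathbf{g}^{ab}\big(\frac{\partial^2F^2}{\partial\mathbf{y}^b\partial\mathbf{x}^c}\mathbf{y}^c-\frac{\partial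 F^2}{\partial\mathbf{x}^b}\big)$, $\mathbf{G}^a_b=\frac{\partial\mathbf{G}^a}{\partial\mathbf{y}^b}$, $\mathbf{G}^c_{ab}=\frac{\partial\mathbf{G}^c_a}{\partial\mathbf{y}^b}$, $\frac{\delta^d}{\delta^d\mathbf{x}^a}=\frac{\partial}{\partial\mathbf{x}^a}-\mathbf{G}^b_a\frac{\partial}{\partial\mathbf{y}^b}$ (the superscript $d$ is a label, not an index), and $$\mathbf{F}^c_{ab}=\tfrac12\mathbf{g}^{ce}\Big(\frac{\delta^d\mathbf{g}_{ea}}{\delta^d\mathbf{x}^b}+\frac{\delta^d\mathbf{g}_{eb}}{\delta^d\mathbf{x}^a}-\frac{\delta^d\mathbf{g}_{ab}}{\delta^d\mathbf{x}^e}\Big).$$ The vertical distribution $VTM^\circ$ is spanned by the $\frac{\partial}{\partial\mathbf{y}^a}$, the horizontal distribution $HTM^\circ$ by the $\frac{\delta^d}{\delta^d\mathbf{x}^a}$, and $TTM^\circ=HTM^\circ\oplus VTM^\circ$. The doubly warped Sasaki–Matsumoto metric on $TM^\circ$ is the Riemannian metric $\mathbf{G}=\mathbf{g}_{ab}\,d\mathbf{x}^a\otimes d\mathbf{x}^b+\mathbf{g}_{ab}\,\delta^d\mathbf{y}^a\otimes\delta^d\mathbf{y}^b$, where $\delta^d\mathbf{y}^a=d\mathbf{y}^a+\mathbf{G}^a_b\,d\mathbf{x}^b$; $\nabla^d$ is its Levi-Civita connection. $VTM^\circ$ is called totally geodesic if $\nabla^d_{\frac{\partial}{\partial\mathbf{y}^a}}\frac{\partial}{\partial\mathbf{y}^b}\in\Gamma(VTM^\circ)$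 for all $a,b$. *)

(* Defs.v *)
From HB Require Import structures.
From mathcomp Require Import all_boot all_order all_algebra.
From mathcomp Require Import all_classical all_reals all_analysis.

Set Implicit Arguments.
Unset Strict Implicit.
Unset Printing Implicit Defensive.

Import Order.TTheory GRing.Theory Num.Theory.
Import numFieldNormedType.Exports.

Local Open Scope classical_set_scope.
Local Open Scope ring_scope.

Section Calculus.
Context {R : realType}.

Definition basis_vec (m : nat) (A : 'I_m) : 'rV[R]_m := delta_mx 0 A.

Definition partial (m : nat) (V : normedModType R) (A : 'I_m)
  (f : 'rV[R]_m -> V) : 'rV[R]_m -> V := fun z => 'D_(basis_vec A) f z.

(* C^oo on an open set W: every iterated partial derivative, f included, is
   Frechet differentiable at every point of W. *)
Definition smooth_on (m : nat) (V : normedModType R) (W : set 'rV[R]_m)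
    (f : 'rV[R]_m -> V) : Prop :=
  forall (s : seq 'I_m) (z : 'rV[R]_m),
    W z -> differentiable (foldr (@partial m V) f s) z.

(* Vector fields on an open set W of R^m are represented by total functions of
   which only the values on W matter. *)
Definition bracket (m : nat) (X Y : 'rV[R]_m -> 'rV[R]_m) :
    'rV[R]_m -> 'rV[R]_m :=
  fun z => 'D_(X z) Y z - 'D_(Y z) X z.

Record affine_connection (m : nat) (W : set 'rV[R]_m)
    (D : ('rV[R]_m -> 'rV[R]_m) -> ('rV[R]_m -> 'rV[R]_m) ->
         'rV[R]_m -> 'rV[R]_m) : Prop := AffineConnection {
  conn_smooth : forall X Y, smooth_on W X -> smooth_on W Y ->
    smooth_on W (D X Y);
  conn_addl : forall X X' Y, smooth_on W X -> smooth_on W X' ->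
    smooth_on W Y -> forall z, W z ->
    D (fun t => X t + X' t) Y z = D X Y z + D X' Y z;
  conn_scalel : forall (h : 'rV[R]_m -> R) X Y, smooth_on W h ->
    smooth_on W X -> smooth_on W Y -> forall z, W z ->
    D (fun t => h t *: X t) Y z = h z *: D X Y z;
  conn_addr : forall X Y Y', smooth_on W X -> smooth_on W Y ->
    smooth_on W Y' -> forall z, W z ->
    D X (fun t => Y t + Y' t) z = D X Y z + D X Y' z;
  conn_leibniz : forall (h : 'rV[R]_m -> R) X Y, smooth_on W h ->
    smooth_on W X -> smooth_on W Y -> forall z, W z ->
    D X (fun t => h t *: Y t) z = 'D_(X z) h z *: Y z + h z *: D X Y z
}.

(* S z X Y is the value of the metric at the point z on the vectors X and Y. *)
Record levi_civita (m : nat) (W : set 'rV[R]_m)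
    (S : 'rV[R]_m -> 'rV[R]_m -> 'rV[R]_m -> R)
    (D : ('rV[R]_m -> 'rV[R]_m) -> ('rV[R]_m -> 'rV[R]_m) ->
         'rV[R]_m -> 'rV[R]_m) : Prop := LeviCivita {
  lc_connection : affine_connection W D;
  lc_torsion_free : forall X Y, smooth_on W X -> smooth_on W Y ->
    forall z, W z -> D X Y z - D Y X z = bracket X Y z;
  lc_metric : forall X Y Z, smooth_on W X -> smooth_on W Y ->
    smooth_on W Z -> forall z, W z ->
    'D_(X z) (fun t => S t (Y t) (Z t)) z =
    S z (D X Y z) (Z z) + S z (Y z) (D X Z z)
}.

End Calculus.

(* The atlas is indexed by [chart]; it need not be maximal.  [cinv i] is the
   inverse of the chart map [cmap i], and only its values on the open set
   [cmap i @` cdom i] matter. *)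
Record manifold (R : realType) (n : nat) := Manifold {
  pts :> topologicalType;
  pts_hausdorff : hausdorff_space pts;
  pts_second_countable : @second_countable pts;
  chart : Type;
  cdom : chart -> set pts;
  cmap : chart -> pts -> 'rV[R]_n;
  cinv : chart -> 'rV[R]_n -> pts;
  cdom_open : forall i, open (cdom i);
  cimg_open : forall i, open (cmap i @` cdom i);
  cmapK : forall i p, cdom i p -> cinv i (cmap i p) = p;
  cmap_continuous : forall i, {within cdom i, continuous (cmap i)};
  cinv_continuous : forall i, {within cmap i @` cdom i, continuous (cinv i)};
  chart_cover : forall p, exists i, cdom i p;
  chart_compat : forall i j,
    smooth_on (cmap i @` (cdom i `&` cdom j)) (cmap j \o cinv i)
}.

Section TangentBundle.
Context {R : realType} {n : nat} (M : manifold R n).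

Definition smooth_fun (f : M -> R) : Prop :=
  forall i : chart M, smooth_on (cmap i @` cdom i) (f \o cinv i).

(* A tangent vector is given by its components in all the charts around its
   base point, subject to the usual transformation law under the differentials
   of the coordinate changes; the components in the other charts are set to 0,
   so that equality of tangent vectors is plain equality. *)
Record tangent_bundle := TangentVector {
  base : M;
  comps : chart M -> 'rV[R]_n;
  comps_out : forall i, ~ cdom i base -> comps i = 0;
  comps_change : forall i j, cdom i base -> cdom j base ->
    comps j = 'D_(comps i) (cmap j \o cinv i) (cmap i base)
}.

Definition transport (i : chart M) (p : M) (y : 'rV[R]_n) (j : chart M) :
    'rV[R]_n :=
  if `[< cdom i p /\ cdom j p >]
  then 'D_y (cmap j \o cinv i) (cmap i p) else 0.

Lemma transport_out (i : chart M) (p : M) y (j : chart M) : ~ cdom j p -> transport i p y j = 0.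
Proof. by move=> nj; rewrite /transport; case: asboolP => // -[]. Qed.

Lemma chart_near (i j : chart M) (p : M) : cdom i p -> cdom j p ->
  \forall x \near cmap i p, cdom j (cinv i x).
Proof.
move=> ip jp.
have Ci : {for cmap i p, continuous (cinv i)}.
  have := @cinv_continuous _ _ M i.
  rewrite continuous_open_subspace; last exact: cimg_open.
  by apply; rewrite inE; exists p.
apply: Ci; rewrite cmapK//.
by apply: open_nbhs_nbhs; split => //; exact: cdom_open.
Qed.

Lemma transport_change (i : chart M) (p : M) y (j k : chart M) : cdom j p -> cdom k p ->
  transport i p y k =
  'D_(transport i p y j) (cmap k \o cinv j) (cmap j p).
Proof.
move=> jp kp; rewrite /transport.
have dd (a b : chart M) : cdom a p -> cdom b p ->
    differentiable (cmap b \o cinv a) (cmap a p).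
  by move=> ap bp; apply: (@chart_compat _ _ M a b [::]); exists p.
case: (pselect (cdom i p)) => ip; last first.
  rewrite !asboolF; try by case.
  by rewrite deriveE ?linear0//; exact: dd.
rewrite !asboolT//.
have -> : 'D_y (cmap k \o cinv i) (cmap i p) =
    'D_y ((cmap k \o cinv j) \o (cmap j \o cinv i)) (cmap i p).
  apply: near_eq_derive.
  have := chart_near ip jp; apply: filterS => x jx /=.
  by rewrite cmapK.
have E : (cmap j \o cinv i) (cmap i p) = cmap j p by rewrite /= cmapK.
have d1 := dd _ _ ip jp.
have d2 : differentiable (cmap k \o cinv j) ((cmap j \o cinv i) (cmap i p)).
  by rewrite E; exact: dd.
rewrite (deriveE _ (differentiable_comp d1 d2)) (deriveE _ d1).
rewrite (deriveE _ (dd _ _ jp kp)).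
apply: etrans (congr1 (fun h => h y) (diff_comp d1 d2)) _.
by rewrite E.
Qed.

(* The tangent vector y^a d/dx^a at p in the chart i (0 if p is outside it). *)
Definition tvec (i : chart M) (p : M) (y : 'rV[R]_n) : tangent_bundle :=
  @TangentVector p (transport i p y)
    (fun j => @transport_out i p y j)
    (fun j k => @transport_change i p y j k).

Lemma tvecK (i : chart M) (v : tangent_bundle) :
  cdom i (base v) -> tvec i (base v) (comps v i) = v.
Proof.
case: v => p c co cc /= ip; rewrite /tvec.
have E : transport i p (c i) = c.
  apply/funext => j; rewrite /transport; case: asboolP => [[_ jp]|nj].
    by rewrite -cc.
  by rewrite co// => jp; apply: nj.
move: (fun j => _) (fun j k => _); rewrite E => a b.
by congr TangentVector; exact: Prop_irrelevance.
Qed.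

(* Points of R^(n + n) are pairs (x, y) of base and fibre coordinates. *)
Definition tb_local (i : chart M) (F : tangent_bundle -> R) :
    'rV[R]_(n + n) -> R :=
  fun z => F (tvec i (cinv i (lsubmx z)) (rsubmx z)).

Definition slit_domain (i : chart M) : set 'rV[R]_(n + n) :=
  [set z | (cmap i @` cdom i) (lsubmx z) /\ rsubmx z <> 0].

Record finsler_metric := FinslerMetric {
  finsler_fun :> tangent_bundle -> R;
  finsler_ge0 : forall v, 0 <= finsler_fun v;
  finsler_smooth : forall i, smooth_on (slit_domain i) (tb_local i finsler_fun);
  finsler_homog : forall i p (c : R) y, cdom i p -> 0 < c ->
    finsler_fun (tvec i p (c *: y)) = c * finsler_fun (tvec i p y);
  finsler_hessian : forall i z (w : 'rV[R]_n), slit_domain i z -> w <> 0 ->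
    0 < \sum_(a < n) \sum_(b < n)
          partial (rshift n a) (partial (rshift n b)
            (fun t => 2^-1 * tb_local i finsler_fun t ^+ 2)) z
          * w 0 a * w 0 b
}.

End TangentBundle.

(* The objects attached to a function F of induced coordinates (x, y). *)
Section LocalFinsler.
Context {R : realType} {n : nat} (F : 'rV[R]_(n + n) -> R).
Implicit Types (a b c e : 'I_n) (z X Y : 'rV[R]_(n + n)).

Definition dx a (f : 'rV[R]_(n + n) -> R) : 'rV[R]_(n + n) -> R :=
  partial (lshift n a) f.
Definition dy a (f : 'rV[R]_(n + n) -> R) : 'rV[R]_(n + n) -> R :=
  partial (rshift n a) f.

Definition Fsq z : R := F z ^+ 2.

Definition gdown a b z : R := 2^-1 * dy a (dy b Fsq) z.
Definition gup a b z : R := invmx (\matrix_(a, b) gdown a b z) a b.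

Definition spray a z : R :=
  4^-1 * \sum_(b < n) gup a b z *
    (\sum_(c < n) dy b (dx c Fsq) z * z 0 (rshift n c) - dx b Fsq z).
(* G^a_b *)
Definition spray1 a b : 'rV[R]_(n + n) -> R := dy b (spray a).
(* G^c_{ab} *)
Definition spray2 c a b : 'rV[R]_(n + n) -> R := dy b (spray1 c a).

(* delta f / delta x^a *)
Definition delta a (f : 'rV[R]_(n + n) -> R) z : R :=
  dx a f z - \sum_(b < n) spray1 b a z * dy b f z.

(* F^c_{ab} *)
Definition hconn c a b z : R :=
  2^-1 * \sum_(e < n) gup c e z *
    (delta b (gdown e a) z + delta a (gdown e b) z - delta e (gdown a b) z).

(* The 1-form delta y^a = dy^a + G^a_b dx^b. *)
Definition delta_y a z X : R :=
  X 0 (rshift n a) + \sum_(b < n) spray1 a b z * X 0 (lshift n b).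

Definition sasaki_matsumoto z X Y : R :=
  \sum_(a < n) \sum_(b < n)
    gdown a b z * X 0 (lshift n a) * Y 0 (lshift n b) +
  \sum_(a < n) \sum_(b < n)
    gdown a b z * delta_y a z X * delta_y b z Y.

Definition vertical X : Prop :=
  exists c : 'I_n -> R, X = \sum_(a < n) c a *: basis_vec (rshift n a).

End LocalFinsler.

Section DoublyWarpedProduct.
Context {R : realType} {n1 n2 : nat}.
Context {M1 : manifold R n1} {M2 : manifold R n2}.
Variables (F1 : finsler_metric M1) (F2 : finsler_metric M2).
Variables (f1 : M1 -> R) (f2 : M2 -> R).

Definition dwp_metric (v1 : tangent_bundle M1) (v2 : tangent_bundle M2) : R :=
  Num.sqrt (f2 (base v2) ^+ 2 * F1 v1 ^+ 2 + f1 (base v1) ^+ 2 * F2 v2 ^+ 2).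

(* Induced coordinates of the product: z = ((x, u), (y, v)). *)
Definition dwp_local (i : chart M1) (j : chart M2) :
    'rV[R]_((n1 + n2) + (n1 + n2)) -> R :=
  fun z => dwp_metric
    (tvec i (cinv i (lsubmx (lsubmx z))) (lsubmx (rsubmx z)))
    (tvec j (cinv j (rsubmx (lsubmx z))) (rsubmx (rsubmx z))).

(* The coordinate image of the slit bundle of the product, which is the product
   of the two slit bundles: both fibre components are nonzero. *)
Definition dwp_domain (i : chart M1) (j : chart M2) :
    set 'rV[R]_((n1 + n2) + (n1 + n2)) :=
  [set z | [/\ (cmap i @` cdom i) (lsubmx (lsubmx z)),
               (cmap j @` cdom j) (rsubmx (lsubmx z)),
               lsubmx (rsubmx z) <> 0 & rsubmx (rsubmx z) <> 0]].

(* A connection on the slit bundle of the product, read in every induced chart.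
   No gluing condition is imposed: for the Levi-Civita connection it follows
   from uniqueness in each chart. *)
Definition dwp_connection : Type :=
  chart M1 -> chart M2 ->
  ('rV[R]_((n1 + n2) + (n1 + n2)) -> 'rV[R]_((n1 + n2) + (n1 + n2))) ->
  ('rV[R]_((n1 + n2) + (n1 + n2)) -> 'rV[R]_((n1 + n2) + (n1 + n2))) ->
  'rV[R]_((n1 + n2) + (n1 + n2)) -> 'rV[R]_((n1 + n2) + (n1 + n2)).

Definition dwp_levi_civita (nabla : dwp_connection) : Prop :=
  forall i j, levi_civita (dwp_domain i j)
    (sasaki_matsumoto (dwp_local i j)) (nabla i j).

Definition vertical_totally_geodesic (nabla : dwp_connection) : Prop :=
  forall i j (a b : 'I_(n1 + n2)) z, dwp_domain i j z ->
    vertical (nabla i j (fun=> basis_vec (rshift (n1 + n2) a))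
                        (fun=> basis_vec (rshift (n1 + n2) b)) z).

End DoublyWarpedProduct.

(* Main.v *)
Require Import Defs.
From mathcomp Require Import all_boot all_order all_algebra.
From mathcomp Require Import all_classical all_reals all_analysis.
From mathcomp Require Import ring.
Import Order.TTheory GRing.Theory Num.Theory.
Import numFieldNormedType.Exports.
Local Open Scope classical_set_scope.
Local Open Scope ring_scope.

(** Fix an induced chart.  Koszul's formula for the constant fields d/dy^a,
    d/dy^b, d/dx^e and d/dy^d, combined along delta/delta x^e, gives
      2 G(nabla_{d/dy^a} d/dy^b, delta/delta x^e)
        = g_bc G^c_ea + g_ac G^c_eb - delta g_ab / delta x^e,
    so the vertical distribution is totally geodesic iff the right-hand side
    vanishes for all a, b, e.  As G^c_ab is symmetric in a and b, Christoffel's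
    permutation of indices shows that this vanishing means exactly that
    G^c_ab = F^c_ab.  The warped structure enters only through the smoothness
    of F^2 and the invertibility of g, which is block diagonal with positive
    definite blocks f2^2 g1 and f1^2 g2. *)

(** * Functions of class C^k and locality of differentiation *)

(* The recursive form of [smooth_on]: closure under products and inverses goes
   by induction on the order of differentiability. *)
Fixpoint Ck {R : realType} {m : nat} (W : set 'rV[R]_m) (k : nat)
    (f : 'rV[R]_m -> R) : Prop :=
  (forall z, W z -> differentiable f z) /\
  (if k is k'.+1 then forall A, Ck W k' (partial A f) else True).

Lemma Ck_differentiable {R : realType} {m : nat} {W : set 'rV[R]_m} k f z :
  Ck W k f -> W z -> differentiable f z.
Proof. by case: k => [|k] [df _] Wz; exact: df. Qed.

Lemma smooth_onP {R : realType} {m : nat} (W : set 'rV[R]_m) (f : 'rV[R]_m -> R) :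
  smooth_on W f <-> forall k, Ck W k f.
Proof.
split=> [sf k|Cf s z Wz].
  elim: k f sf => [|k IH] f sf; split=> //; first by move=> z; exact: (sf [::]).
    by move=> z; exact: (sf [::]).
  by move=> A; apply: IH => s z Wz; have := sf (rcons s A) z Wz; rewrite foldr_rcons.
elim/last_ind: s f Cf => [|s A IH] f Cf /=; first exact: Ck_differentiable (Cf 0%N) Wz.
rewrite foldr_rcons; apply: IH => k; case: (Cf k.+1) => _; exact.
Qed.

Lemma CkW {R : realType} {m : nat} {W : set 'rV[R]_m} k f : Ck W k.+1 f -> Ck W k f.
Proof.
elim: k f => [|k IH] f [df pf]; split=> // A.
by apply: IH; exact: pf.
Qed.

Lemma eq_on_partial {R : realType} {m : nat} {W : set 'rV[R]_m} {V : normedModType R}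
    (f g : 'rV[R]_m -> V) A :
  open W -> {in W, f =1 g} -> {in W, partial A f =1 partial A g}.
Proof.
move=> oW fg z; rewrite inE => Wz; apply: near_eq_derive.
have : nbhs z W by apply: open_nbhs_nbhs.
by apply: filterS => t Wt; apply: fg; rewrite inE.
Qed.

(** The null map gives an exact first-order expansion near z, so uniqueness of the differential
    identifies ['d h z] with it. Applied to a difference g - f, this transfers differentiability
    between functions that agree on an open set. *)
Lemma near0_is_diff {R : realType} {V W : normedModType R} (h : V -> W) (z : V) :
  (\forall t \near z, h t = 0) -> differentiable h z.
Proof.
move=> h0; have hz : h z = 0 by exact: nbhs_singleton h0.
have c0 : continuous (\0 : V -> W) by move=> x; exact: cst_continuous.
have ho : h \o shift z = cst (h z) + (\0 : V -> W) +o_ 0 id.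
  apply/eqaddoP => _/posnumP[e]; move: h0; rewrite (near_shift 0) subr0.
  apply: filterS => t /= ht.
  by rewrite !fctE /= ht hz addr0 subrr normr0 mulr_ge0.
apply/diff_locallyP.
have -> : 'd h z = (\0 : V -> W) :> (V -> W) by exact: diff_unique ho.
by split.
Qed.

Lemma eq_on_differentiable {R : realType} {m : nat} {W : set 'rV[R]_m}
    (f g : 'rV[R]_m -> R) z :
  open W -> {in W, f =1 g} -> W z -> differentiable f z -> differentiable g z.
Proof.
move=> oW fg Wz df.
have -> : g = f + (g - f) by rewrite addrC subrK.
apply: differentiableD => //; apply: near0_is_diff.
have : nbhs z W by apply: open_nbhs_nbhs.
by apply: filterS => t Wt; rewrite !fctE fg ?inE// subrr.
Qed.

(** * Symmetry of mixed second derivatives *)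

Lemma dist_le_split {R : realType} {a b p q e : R} :
  p = q -> `|a - p| < e / 2 -> `|b - q| < e / 2 -> `|a - b| <= e.
Proof.
move=> -> ap bp; apply: (le_trans (ler_distD q _ _)).
by rewrite [leRHS]splitr (distrC q) lerD// ltW.
Qed.

Lemma is_derive_line {R : realType} {V W : normedModType R} (f : V -> W) (z u : V) (t : R) :
  derivable f (z + t *: u) u ->
  is_derive t (1 : R) (fun t => f (z + t *: u)) ('D_u f (z + t *: u)).
Proof.
move=> df.
have E : (fun h : R => h^-1 *: (((fun t => f (z + t *: u)) \o shift t) (h *: 1) - f (z + t *: u))) =
         (fun h : R => h^-1 *: ((f \o shift (z + t *: u)) (h *: u) - f (z + t *: u))).
  apply/funext => h /=; congr (_ *: (f _ - _)).
  by rewrite scalerDl addrCA -[h *: 1]/(h * 1) mulr1.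
by apply: DeriveDef; rewrite /derivable /derive E.
Qed.

Lemma MVT_line {R : realType} {V : normedModType R} (f : V -> R) (z u : V) (h : R) :
  0 <= h -> (forall t, 0 <= t <= h -> derivable f (z + t *: u) u) ->
  exists2 t, 0 <= t <= h & f (z + h *: u) - f z = 'D_u f (z + t *: u) * h.
Proof.
move=> h0 df.
have [||t] := @MVT_segment R (fun t => f (z + t *: u)) (fun t => 'D_u f (z + t *: u)) _ _ h0.
- move=> t /andP[/ltW t0 /ltW th]; apply: is_derive_line; apply: df.
  by apply/andP; split.
- apply: derivable_within_continuous => t; rewrite in_itv /= => th.
  by apply: ex_derive; apply: is_derive_line; exact: df.
- by rewrite in_itv /= scale0r addr0 subr0 => th E; exists t.
Qed.

(** The mean value theorem is used twice: along u for the increment p |-> f (p + h v) - f p, then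
    along v for ['D_u f]. The left-hand side is symmetric in u and v, which is what makes Schwarz's
    theorem work. *)
Lemma second_difference {R : realType} {V : normedModType R} (f : V -> R) (z u v : V) (h : R) :
  0 <= h ->
  (forall t s, 0 <= t <= h -> 0 <= s <= h ->
    derivable f (z + t *: u + s *: v) u /\ derivable ('D_u f) (z + t *: u + s *: v) v) ->
  exists t s, [/\ 0 <= t <= h, 0 <= s <= h &
    f (z + h *: u + h *: v) - f (z + h *: u) - f (z + h *: v) + f z =
    'D_v ('D_u f) (z + t *: u + s *: v) * h ^+ 2].
Proof.
move=> h0 df.
have hh : 0 <= h <= h by rewrite h0 lexx.
have oo : 0 <= (0 : R) <= h by rewrite lexx h0.
pose phi p := f (p + h *: v) - f p.
have dphi t : 0 <= t <= h -> is_derive (z + t *: u) u phi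
    ('D_u f (z + t *: u + h *: v) - 'D_u f (z + t *: u)).
  move=> th; rewrite /phi; apply: is_deriveB; last first.
    by apply: derivableP; have [+ _] := df _ _ th oo; rewrite scale0r addr0.
  have [d _] := df _ _ th hh.
  have E : (fun k : R => k^-1 *: (((fun p => f (p + h *: v)) \o shift (z + t *: u)) (k *: u) - f (z + t *: u + h *: v))) =
         (fun k : R => k^-1 *: ((f \o shift (z + t *: u + h *: v)) (k *: u) - f (z + t *: u + h *: v))).
    by apply/funext => k /=; rewrite !addrA.
  by apply: DeriveDef; rewrite /derivable /derive E.
have [|t th E] := @MVT_line R V phi z u h h0.
  by move=> t th; apply: ex_derive; exact: dphi.
have [|s sh E'] := @MVT_line R V ('D_u f) (z + t *: u) v h h0.
  by move=> s sh; have [] := df _ _ th sh.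
exists t, s; split=> //.
have := E; rewrite (@derive_val _ _ _ _ _ _ _ (dphi _ th)) E' /phi -mulrA -expr2 => <-.
by rewrite opprB addrA [RHS]addrAC.
Qed.

(** Schwarz's theorem: the second difference over a small parallelogram is h^2 times either mixed
    derivative, each taken at some point of the parallelogram. Continuity at z then brings the two
    values at z within any e > 0 of each other. *)
Lemma derive_comm {R : realType} {V : normedModType R} (W : set V) (f : V -> R) (z u v : V) :
  open W -> W z ->
  (forall p, W p -> [/\ differentiable f p, differentiable ('D_u f) p & differentiable ('D_v f) p]) ->
  {for z, continuous ('D_v ('D_u f))} -> {for z, continuous ('D_u ('D_v f))} ->
  'D_v ('D_u f) z = 'D_u ('D_v f) z.
Proof.
move=> oW Wz df c1 c2; apply/eqP; rewrite -subr_eq0 -normr_le0; apply/ler_addgt0Pl => e e0.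
rewrite addr0.
have e2 : 0 < e / 2 by rewrite divr_gt0.
have : \forall p \near z, [/\ W p, `|'D_v ('D_u f) z - 'D_v ('D_u f) p| < e / 2 &
    `|'D_u ('D_v f) z - 'D_u ('D_v f) p| < e / 2].
  have Wn : nbhs z W by exact: open_nbhs_nbhs.
  have n1 : \forall p \near z, `|'D_v ('D_u f) z - 'D_v ('D_u f) p| < e / 2.
    by move/cvgrPdist_lt: c1; apply.
  have n2 : \forall p \near z, `|'D_u ('D_v f) z - 'D_u ('D_v f) p| < e / 2.
    by move/cvgrPdist_lt: c2; apply.
  by apply: filterS3 Wn n1 n2 => p; split.
move=> /nbhs_ballP[r /= r0 rP].
(* With this h the parallelogram at z spanned by h u and h v stays inside the ball of radius r; the
   1 keeps the denominator positive and the bound strict. *)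
pose h := r / (`|u| + `|v| + 1).
have N0 : 0 < `|u| + `|v| + 1 by rewrite ltr_pwDr// addr_ge0.
have h0 : 0 < h by rewrite divr_gt0.
have inb t s : 0 <= t <= h -> 0 <= s <= h -> ball z r (z + t *: u + s *: v).
  move=> /andP[t0 th] /andP[s0 sh]; rewrite -ball_normE /= -addrA opprD addrA subrr add0r normrN.
  apply: le_lt_trans (ler_normD _ _) _; rewrite !normrZ !ger0_norm//.
  apply: (@le_lt_trans _ _ (h * (`|u| + `|v|))).
    by rewrite mulrDr lerD// ler_wpM2r.
  by rewrite /h mulrAC -mulrA gtr_pMr// ltr_pdivrMr// mul1r ltrDl.
have [|t [s [th sh E]]] := @second_difference R V f z u v h (ltW h0).
  move=> t s th sh; have [Wp _ _] := rP _ (inb t s th sh).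
  by have [d1 d2 d3] := df _ Wp; split; apply: diff_derivable.
have inb' t' s' : 0 <= t' <= h -> 0 <= s' <= h -> ball z r (z + t' *: v + s' *: u).
  by move=> t'h s'h; rewrite addrAC; exact: inb.
have [|t' [s' [th' sh' E']]] := @second_difference R V f z v u h (ltW h0).
  move=> t' s' t'h s'h; have [Wp _ _] := rP _ (inb' t' s' t'h s'h).
  by have [d1 d2 d3] := df _ Wp; split; apply: diff_derivable.
(* Both sides times h^2 are the same second difference, up to the order of its terms. *)
have EE : 'D_v ('D_u f) (z + t *: u + s *: v) = 'D_u ('D_v f) (z + t' *: v + s' *: u).
  have h2 : h ^+ 2 != 0 by rewrite expf_neq0// gt_eqF.
  apply: (mulIf h2); apply: etrans (esym E) _; apply: etrans E'.
  by rewrite (addrAC z (h *: v)); congr (_ + _); rewrite -!addrA [- _ - _]addrC.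
have [_ l1 _] := rP _ (inb t s th sh); have [_ _ l2] := rP _ (inb' t' s' th' sh').
exact: (dist_le_split EE l1 l2).
Qed.

(** * Closure properties of smooth functions *)

Lemma eq_on_Ck {R : realType} {m : nat} {W : set 'rV[R]_m} k (f g : 'rV[R]_m -> R) :
  open W -> {in W, f =1 g} -> Ck W k f -> Ck W k g.
Proof.
move=> oW; elim: k f g => [|k IH] f g fg [df pf]; split=> //.
- by move=> z Wz; apply: (eq_on_differentiable _ _ _ oW fg Wz); exact: df.
- by move=> z Wz; apply: (eq_on_differentiable _ _ _ oW fg Wz); exact: df.
- by move=> A; apply: IH (pf A); exact: eq_on_partial.
Qed.

Lemma partialD {R : realType} {m : nat} (f g : 'rV[R]_m -> R) A z :
  differentiable f z -> differentiable g z ->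
  partial A (fun t => f t + g t) z = partial A f z + partial A g z.
Proof. by move=> df dg; apply: deriveD; exact: diff_derivable. Qed.

Lemma partialM {R : realType} {m : nat} (f g : 'rV[R]_m -> R) A z :
  differentiable f z -> differentiable g z ->
  partial A (fun t => f t * g t) z = partial A f z * g z + f z * partial A g z.
Proof.
move=> df dg; apply: etrans (deriveM _ _) _; [exact: diff_derivable..|].
by rewrite addrC; congr (_ + _); exact: mulrC.
Qed.

Lemma partialV {R : realType} {m : nat} (f : 'rV[R]_m -> R) A z :
  differentiable f z -> f z != 0 ->
  partial A (fun t => (f t)^-1) z = - (partial A f z * ((f z)^-1 * (f z)^-1)).
Proof.
move=> df f0; apply: etrans (deriveV f0 _) _; first exact: diff_derivable.
by rewrite scaleNr -exprVn expr2; congr (- _); exact: mulrC.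
Qed.

Lemma partial_cst {R : realType} {m : nat} {V : normedModType R} (c : V) (A : 'I_m) :
  partial A (fun=> c) = fun=> 0.
Proof. by apply/funext => z; exact: derive_cst. Qed.

Lemma smooth_on_cst {R : realType} {m : nat} {V : normedModType R} (W : set 'rV[R]_m) (c : V) :
  smooth_on W (fun=> c).
Proof.
(* Every iterated partial derivative is again constant, but its value drops to 0 after the first
   differentiation, hence the existential. *)
move=> s z _; suff [d ->] : exists d, foldr (@partial R m V) (fun=> c) s = fun=> d.
  exact: differentiable_cst.
elim: s => [|A s [d IH]] /=; first by exists c.
by exists 0; rewrite IH partial_cst.
Qed.

Lemma CkD {R : realType} {m : nat} {W : set 'rV[R]_m} k (f g : 'rV[R]_m -> R) :
  open W -> Ck W k f -> Ck W k g -> Ck W k (fun z => f z + g z).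
Proof.
move=> oW; elim: k f g => [|k IH] f g Cf Cg; split=> //;
    try (by move=> z Wz; apply: differentiableD; apply: Ck_differentiable Wz; eassumption).
move=> A; have [_ pf] := Cf; have [_ pg] := Cg.
apply: eq_on_Ck (IH _ _ (pf A) (pg A)) => // z; rewrite inE => Wz.
by rewrite partialD//; apply: Ck_differentiable Wz; eassumption.
Qed.

(** In each term of the product rule one factor is left undifferentiated; [CkW] lowers its order by
    one so that the induction hypothesis applies. *)
Lemma CkM {R : realType} {m : nat} {W : set 'rV[R]_m} k (f g : 'rV[R]_m -> R) :
  open W -> Ck W k f -> Ck W k g -> Ck W k (fun z => f z * g z).
Proof.
move=> oW; elim: k f g => [|k IH] f g Cf Cg; split=> //;
    try (by move=> z Wz; apply: differentiableM; apply: Ck_differentiable Wz; eassumption).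
move=> A; have [_ pf] := Cf; have [_ pg] := Cg.
have C := CkD k _ _ oW (IH _ _ (pf A) (CkW _ _ Cg)) (IH _ _ (CkW _ _ Cf) (pg A)).
apply: eq_on_Ck C => // z; rewrite inE => Wz.
by rewrite partialM//; apply: Ck_differentiable Wz; eassumption.
Qed.

Lemma smooth_onD {R : realType} {m : nat} {W : set 'rV[R]_m} (f g : 'rV[R]_m -> R) :
  open W -> smooth_on W f -> smooth_on W g -> smooth_on W (fun z => f z + g z).
Proof.
by move=> oW /smooth_onP sf /smooth_onP sg; apply/smooth_onP => k; exact: CkD.
Qed.

Lemma smooth_onM {R : realType} {m : nat} {W : set 'rV[R]_m} (f g : 'rV[R]_m -> R) :
  open W -> smooth_on W f -> smooth_on W g -> smooth_on W (fun z => f z * g z).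
Proof.
by move=> oW /smooth_onP sf /smooth_onP sg; apply/smooth_onP => k; exact: CkM.
Qed.

Lemma smooth_onN {R : realType} {m : nat} {W : set 'rV[R]_m} (f : 'rV[R]_m -> R) :
  open W -> smooth_on W f -> smooth_on W (fun z => - f z).
Proof.
move=> oW sf; under eq_fun do rewrite -mulN1r.
by apply: smooth_onM => //; exact: smooth_on_cst.
Qed.

Lemma smooth_on_sum {R : realType} {m : nat} {W : set 'rV[R]_m} {I : Type}
    (s : seq I) (P : pred I) (f : I -> 'rV[R]_m -> R) :
  open W -> (forall i, smooth_on W (f i)) ->
  smooth_on W (fun z => \sum_(i <- s | P i) f i z).
Proof.
move=> oW sf; elim: s => [|i s IH].
  by under eq_fun do rewrite big_nil; exact: smooth_on_cst.
under eq_fun do rewrite big_cons; case: (P i) => //.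
exact: smooth_onD.
Qed.

Lemma smooth_on_prod {R : realType} {m : nat} {W : set 'rV[R]_m} {I : Type}
    (s : seq I) (P : pred I) (f : I -> 'rV[R]_m -> R) :
  open W -> (forall i, smooth_on W (f i)) ->
  smooth_on W (fun z => \prod_(i <- s | P i) f i z).
Proof.
move=> oW sf; elim: s => [|i s IH].
  by under eq_fun do rewrite big_nil; exact: smooth_on_cst.
under eq_fun do rewrite big_cons; case: (P i) => //.
exact: smooth_onM.
Qed.

(** The derivative of 1/f is - f' (1/f)^2, so if 1/f is of class C^k then its partial derivatives
    are too, and the order rises by one. *)
Lemma smooth_onV {R : realType} {m : nat} {W : set 'rV[R]_m} (f : 'rV[R]_m -> R) :
  open W -> smooth_on W f -> (forall z, W z -> f z != 0) ->
  smooth_on W (fun z => (f z)^-1).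
Proof.
move=> oW /smooth_onP sf f0; apply/smooth_onP => k.
have dV z : W z -> differentiable (fun z => (f z)^-1) z.
  by move=> Wz; apply: differentiableV; [exact: Ck_differentiable (sf 0%N) Wz|exact: f0].
elim: k => [|k IH]; split=> // A.
have CN := smooth_on_cst W (-1 : R); move/smooth_onP: CN => CN.
have [_ pf] := sf k.+1.
have C := CkM _ _ _ oW (CN k) (CkM _ _ _ oW (pf A) (CkM _ _ _ oW IH IH)).
apply: eq_on_Ck C => // z; rewrite inE => Wz.
by rewrite mulN1r partialV ?f0//; exact: Ck_differentiable (sf 0%N) Wz.
Qed.

Lemma smooth_on_partial {R : realType} {m : nat} {W : set 'rV[R]_m} A (f : 'rV[R]_m -> R) :
  smooth_on W f -> smooth_on W (partial A f).
Proof. by move=> sf s z Wz; have := sf (rcons s A) z Wz; rewrite foldr_rcons. Qed.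

Lemma smooth_on_differentiable {R : realType} {m : nat} {V : normedModType R}
  {W : set 'rV[R]_m} (f : 'rV[R]_m -> V) z :
  smooth_on W f -> W z -> differentiable f z.
Proof. by move=> sf Wz; exact: (sf [::]). Qed.

Lemma smooth_on_coord {R : realType} {m : nat} (W : set 'rV[R]_m) (k : 'I_m) :
  smooth_on W (fun z : 'rV[R]_m => z 0 k).
Proof.
have dc z : differentiable (fun z : 'rV[R]_m => z 0 k) z by exact: differentiable_coord.
apply/smooth_onP => -[|n]; split=> // A.
have -> : partial A (fun z : 'rV[R]_m => z 0 k) = fun=> basis_vec A 0 k.
  apply/funext => z; rewrite /partial.
  (* The difference quotient is constant away from h = 0. *)
  have E : (fun h : R => h^-1 *: (((fun z : 'rV[R]_m => z 0 k) \o shift z) (h *: basis_vec A) - z 0 k)) @ 0^'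
      --> (basis_vec A 0 k : R).
    apply: cvg_near_cst; near=> h; rewrite /= !mxE addrK.
    apply: etrans (mulrA _ _ _) _; rewrite mulVf ?mul1r//.
    by near: h; exact: nbhs_dnbhs_neq.
  exact: cvg_lim E.
exact: (smooth_onP W _).1 (smooth_on_cst W _) n.
Unshelve. all: by end_near. Qed.

Lemma partial_comm {R : realType} {m : nat} {W : set 'rV[R]_m} (A B : 'I_m) (f : 'rV[R]_m -> R) z :
  open W -> smooth_on W f -> W z -> partial A (partial B f) z = partial B (partial A f) z.
Proof.
move=> oW sf Wz; apply: (derive_comm W) => //.
- by move=> p Wp; split; [exact: (sf [::])|exact: (sf [:: B])|exact: (sf [:: A])].
- by apply: differentiable_continuous; exact: (sf [:: A; B]).
- by apply: differentiable_continuous; exact: (sf [:: B; A]).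
Qed.

Lemma partial_comp_lin {R : realType} {m n : nat} (L : {linear 'rV[R]_m -> 'rV[R]_n})
    (f : 'rV[R]_n -> R) A z :
  differentiable f (L z) ->
  partial A (f \o L) z = \sum_(k < n) L (basis_vec A) 0 k * partial k f (L z).
Proof.
move=> df.
have E : (fun h : R => h^-1 *: (((f \o L) \o shift z) (h *: basis_vec A) - (f \o L) z)) =
         (fun h : R => h^-1 *: ((f \o shift (L z)) (h *: L (basis_vec A)) - f (L z))).
  by apply/funext => h /=; rewrite (linearD L) linearZ_LR.
have -> : partial A (f \o L) z = 'D_(L (basis_vec A)) f (L z) by rewrite /partial /derive E.
rewrite deriveE// [X in 'd _ _ X]row_sum_delta linear_sum; apply: eq_bigr => k _.
by rewrite linearZ_LR /partial deriveE.
Qed.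

Lemma eq_on_smooth {R : realType} {m : nat} {W : set 'rV[R]_m} (f g : 'rV[R]_m -> R) :
  open W -> {in W, f =1 g} -> smooth_on W f -> smooth_on W g.
Proof.
move=> oW fg /smooth_onP sf; apply/smooth_onP => k.
exact: eq_on_Ck oW fg (sf k).
Qed.

(** By the chain rule the partial derivatives of f \o L are combinations, with constant
    coefficients, of partial derivatives of f composed with L, so the induction on the order is
    carried out for all smooth f at once. *)
Lemma smooth_on_comp_lin {R : realType} {m n : nat} (W : set 'rV[R]_m) (U : set 'rV[R]_n)
    (L : {linear 'rV[R]_m -> 'rV[R]_n}) (f : 'rV[R]_n -> R) :
  open W -> continuous L -> (forall z, W z -> U (L z)) -> smooth_on U f ->
  smooth_on W (f \o L).
Proof.
move=> oW cL WU sf; apply/smooth_onP => k.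
have dC (g : 'rV[R]_n -> R) z : smooth_on U g -> W z -> differentiable (g \o L) z.
  move=> sg Wz; apply: differentiable_comp; first exact: linear_differentiable.
  by apply: smooth_on_differentiable sg _; exact: WU.
elim: k f sf => [|k IH] f sf; split=> //; try (by move=> z; exact: dC).
move=> A; have C : Ck W k (fun z => \sum_(i < n) L (basis_vec A) 0 i * (partial i f \o L) z).
  elim: (index_enum _) => [|i s IHs].
    under eq_fun do rewrite big_nil.
    exact: (smooth_onP W _).1 (smooth_on_cst W _) k.
  under eq_fun do rewrite big_cons.
  apply: CkD => //; apply: CkM => //; first exact: (smooth_onP W _).1 (smooth_on_cst W _) k.
  by apply: IH; exact: smooth_on_partial.
apply: eq_on_Ck C => // z; rewrite inE => Wz.
by rewrite partial_comp_lin//; exact: smooth_on_differentiable sf (WU _ Wz).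
Qed.

Lemma smooth_on_det {R : realType} {m n : nat} {W : set 'rV[R]_m} (M : 'rV[R]_m -> 'M[R]_n) :
  open W -> (forall i j, smooth_on W (fun z => M z i j)) ->
  smooth_on W (fun z => \det (M z)).
Proof.
move=> oW sM; apply: smooth_on_sum => // s; apply: smooth_onM => //; first exact: smooth_on_cst.
exact: smooth_on_prod.
Qed.

(** Cramer's rule writes each entry as a cofactor, a polynomial in the entries of M, over the
    determinant, which does not vanish on W. *)
Lemma smooth_on_invmx {R : realType} {m n : nat} {W : set 'rV[R]_m} (M : 'rV[R]_m -> 'M[R]_n) i j :
  open W -> (forall i j, smooth_on W (fun z => M z i j)) ->
  (forall z, W z -> M z \in unitmx) ->
  smooth_on W (fun z => invmx (M z) i j).
Proof.
move=> oW sM uM.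
have s : smooth_on W (fun z => (\det (M z))^-1 * cofactor (M z) j i).
  apply: smooth_onM => //.
    apply: smooth_onV => //; first exact: smooth_on_det.
    by move=> z Wz; rewrite -unitfE -unitmxE uM.
  apply: smooth_onM => //; first exact: smooth_on_cst.
  apply: smooth_on_det => // k l.
  by under eq_fun do rewrite !mxE; exact: sM.
apply: eq_on_smooth s => // z; rewrite inE => Wz.
by rewrite /invmx uM// !mxE.
Qed.

(** * Smoothness and symmetry of the local Finsler objects *)

Lemma eq_delta {R : realType} {n : nat} (F f g : 'rV[R]_(n + n) -> R) (e : 'I_n) z :
  (forall i, partial i f z = partial i g z) -> delta F e f z = delta F e g z.
Proof.
by move=> fg; rewrite /delta /dx /dy fg; under eq_bigr do rewrite fg.
Qed.

Section LocalGeometry.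
Context {R : realType} {n : nat} {F : 'rV[R]_(n + n) -> R} {W : set 'rV[R]_(n + n)}.
Hypothesis oW : open W.
Hypothesis sF : smooth_on W (Fsq F).
Hypothesis uF : forall z, W z -> (\matrix_(a, b) gdown F a b z) \in unitmx.
Implicit Types (a b c d e : 'I_n) (z : 'rV[R]_(n + n)).

Lemma smooth_gdown a b : smooth_on W (gdown F a b).
Proof.
apply: smooth_onM => //; first exact: smooth_on_cst.
by do 2 apply: smooth_on_partial.
Qed.

Lemma gdown_sym a b z : W z -> gdown F a b z = gdown F b a z.
Proof. by move=> Wz; rewrite /gdown /dy (partial_comm _ _ _ _ oW sF Wz). Qed.

Lemma smooth_spray a : smooth_on W (spray F a).
Proof.
have s b : smooth_on W (fun z => \sum_(c < n) dy b (dx c (Fsq F)) z * z 0 (rshift n c) - dx b (Fsq F) z).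
  apply: smooth_onD => //.
    apply: smooth_on_sum => // c; apply: smooth_onM => //; last exact: smooth_on_coord.
    by do 2 apply: smooth_on_partial.
  by apply: smooth_onN => //; apply: smooth_on_partial.
have g b : smooth_on W (gup F a b).
  apply: smooth_on_invmx => // i j.
  by under eq_fun do rewrite mxE; exact: smooth_gdown.
rewrite /spray; under eq_fun do rewrite mulr_sumr.
apply: smooth_on_sum => // b.
apply: smooth_onM => //; first exact: smooth_on_cst.
exact: smooth_onM.
Qed.

Lemma smooth_spray1 a b : smooth_on W (spray1 F a b).
Proof. exact/smooth_on_partial/smooth_spray. Qed.

(** G^c_ab is a second fibre derivative of the smooth function G^c. This symmetry plays the part of
    torsion-freeness in [christoffelP]. *)
Lemma spray2_sym c a b z : W z -> spray2 F c a b z = spray2 F c b a z.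
Proof. by move=> Wz; rewrite /spray2 /spray1 /dy (partial_comm _ _ _ _ oW (smooth_spray c) Wz). Qed.

Lemma delta_gdown_sym a b e z : W z -> delta F e (gdown F a b) z = delta F e (gdown F b a) z.
Proof.
move=> Wz; have E i : partial i (gdown F a b) z = partial i (gdown F b a) z.
  have S : {in W, gdown F a b =1 gdown F b a}.
    by move=> t; rewrite inE; exact: gdown_sym.
  by apply: (eq_on_partial (gdown F a b) (gdown F b a) i oW S z); rewrite inE.
exact: eq_delta E.
Qed.
End LocalGeometry.

(** * Christoffel's permutation of indices and Koszul's formula *)

(** [Dl e a b] stands for the derivative of g_ab along e, so the first condition is metric
    compatibility of [Gam]. Adding two cyclic instances of it and subtracting the third isolates
    twice the lowered symbol; the converse is substitution. *)
Lemma christoffelP {R : realType} {n : nat} (g : 'M[R]_n) (Gam Dl : 'I_n -> 'I_n -> 'I_n -> R) :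
  g \in unitmx -> (forall c a b, Gam c a b = Gam c b a) ->
  (forall e a b, Dl e a b = Dl e b a) ->
  (forall a b e, \sum_c g b c * Gam c e a + \sum_c g a c * Gam c e b = Dl e a b) <->
  (forall a b c, 2^-1 * \sum_e invmx g c e * (Dl b e a + Dl a e b - Dl e a b) = Gam c a b).
Proof.
move=> ug GamC DlC.
pose low e a b := \sum_c g e c * Gam c a b.
have lowC e a b : low e a b = low e b a by apply: eq_bigr => c _; rewrite GamC.
(* Raising the lowered index recovers [Gam], since g is invertible. *)
have invl c a b : \sum_e invmx g c e * low e a b = Gam c a b.
  have := congr1 (fun M : 'cV[R]_n => M c 0) (mulKmx ug (\col_d Gam d a b)).
  rewrite !mxE => <-; apply: eq_bigr => e _; rewrite !mxE; congr (_ * _).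
  by apply: eq_bigr => d _; rewrite mxE.
split=> [met|chr] a b => [c|e].
  rewrite -[RHS]invl mulr_sumr; apply: eq_bigr => e _.
  rewrite -!met -!/(low _ _ _) (lowC b e a) (lowC a e b) (lowC a b e) (lowC b a e) (lowC e b a).
  by field.
(* Multiplying the Christoffel formula by g gives the lowered symbols in terms of [Dl]. *)
have lowE e' a' b' : low e' a' b' = 2^-1 * (Dl b' e' a' + Dl a' e' b' - Dl e' a' b').
  have := congr1 (fun M : 'cV[R]_n => M e' 0)
    (mulKVmx ug (\col_d (2^-1 * (Dl b' d a' + Dl a' d b' - Dl d a' b')))).
  rewrite !mxE => <-; apply: eq_bigr => d _; congr (_ * _).
  by rewrite -chr !mxE mulr_sumr; apply: eq_bigr => i _; rewrite mxE mulrCA.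
rewrite -/(low _ _ _) -/(low a e b) !lowE (DlC a b e) (DlC b a e) (DlC e b a).
by field.
Qed.

(** Replaces membership in a span by scalar equations, the form that pairings with horizontal
    vectors can test. *)
Lemma verticalP {R : realType} {n : nat} (X : 'rV[R]_(n + n)) :
  vertical X <-> forall e : 'I_n, X 0 (lshift n e) = 0.
Proof.
split=> [[c ->] e|X0].
  rewrite summxE big1// => a _; rewrite /basis_vec !mxE.
  by rewrite eq_lrshift andbF mulr0.
exists (fun a => X 0 (rshift n a)).
rewrite [LHS]row_sum_delta big_split_ord /= big1 ?add0r// => a _.
by rewrite X0 scale0r.
Qed.

(** Constant fields have zero brackets, so the three bracket terms of Koszul's formula disappear. *)
Lemma koszul_cst {R : realType} {m : nat} {W : set 'rV[R]_m} {S D} (X Y Z : 'rV[R]_m) z :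
  levi_civita W S D -> W z -> (forall U V, S z U V = S z V U) ->
  2 * S z (D (fun=> X) (fun=> Y) z) Z =
  'D_X (fun t => S t Y Z) z + 'D_Y (fun t => S t X Z) z - 'D_Z (fun t => S t X Y) z.
Proof.
move=> [_ torsion metric] Wz symS.
have sc (V : 'rV[R]_m) : smooth_on W (fun=> V) by exact: smooth_on_cst.
have tor U V : D (fun=> U) (fun=> V) z = D (fun=> V) (fun=> U) z.
  apply/eqP; rewrite -subr_eq0; apply/eqP.
  apply: etrans (torsion _ _ (sc U) (sc V) _ Wz) _.
  by apply: etrans (congr2 _ (derive_cst _ _ _) (congr1 _ (derive_cst _ _ _))) _; rewrite subr0.
have met U V T : 'D_U (fun t => S t V T) z =
    S z (D (fun=> U) (fun=> V) z) T + S z V (D (fun=> U) (fun=> T) z).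
  exact: (metric _ _ _ (sc U) (sc V) (sc T) _ Wz).
rewrite !met (tor Y X) (tor Z X) (tor Z Y) (symS (D (fun=> X) (fun=> Z) z) Y).
by ring.
Qed.

(** * The Sasaki-Matsumoto metric on coordinate fields *)

Section SasakiMatsumoto.
Context {R : realType} {n : nat} (F : 'rV[R]_(n + n) -> R).
Implicit Types (a b c d e : 'I_n) (z X Y : 'rV[R]_(n + n)).

Let pick_sum (G : 'I_n -> R) d : \sum_a G a * (a == d)%:R = G d.
Proof.
rewrite (bigD1 d)//= eqxx mulr1 big1 ?addr0// => a /negbTE ->.
by rewrite mulr0.
Qed.

Let basisE (m : nat) (i j : 'I_m) : (basis_vec i : 'rV[R]_m) 0 j = (j == i)%:R.
Proof. by rewrite /basis_vec mxE eqxx. Qed.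

Lemma delta_y_vert a d z : delta_y F a z (basis_vec (rshift n d)) = (a == d)%:R.
Proof.
rewrite /delta_y basisE eq_rshift big1 ?addr0// => b _.
by rewrite basisE eq_lrshift mulr0.
Qed.

Lemma delta_y_hor a e z : delta_y F a z (basis_vec (lshift n e)) = spray1 F a e z.
Proof.
rewrite /delta_y basisE eq_rlshift add0r -[RHS](pick_sum (fun b => spray1 F a b z)).
by apply: eq_bigr => b _; rewrite basisE eq_lshift.
Qed.

(** The forms dx^a kill d/dy^d, which leaves the vertical block, and delta y^b takes the value 1 or
    0 on it. *)
Lemma sasaki_matsumoto_vertr z X d :
  sasaki_matsumoto F z X (basis_vec (rshift n d)) =
  \sum_a gdown F a d z * delta_y F a z X.
Proof.
rewrite /sasaki_matsumoto big1 ?add0r => [|a _]; last first.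
  by rewrite big1// => b _; rewrite basisE eq_lrshift mulr0.
apply: eq_bigr => a _.
rewrite -[RHS](pick_sum (fun b => gdown F a b z * delta_y F a z X)).
by apply: eq_bigr => b _; rewrite delta_y_vert.
Qed.

Lemma sasaki_matsumoto_horr z X e :
  sasaki_matsumoto F z X (basis_vec (lshift n e)) =
  \sum_a gdown F a e z * X 0 (lshift n a) +
  \sum_a \sum_b gdown F a b z * delta_y F a z X * spray1 F b e z.
Proof.
rewrite /sasaki_matsumoto; congr (_ + _); apply: eq_bigr => a _; last first.
  by apply: eq_bigr => b _; rewrite delta_y_hor.
rewrite -[RHS](pick_sum (fun b => gdown F a b z * X 0 (lshift n a))).
by apply: eq_bigr => b _; rewrite basisE eq_lshift.
Qed.

Lemma sasaki_matsumoto_vert_vert z a b :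
  sasaki_matsumoto F z (basis_vec (rshift n a)) (basis_vec (rshift n b)) = gdown F a b z.
Proof.
rewrite sasaki_matsumoto_vertr -[RHS](pick_sum (fun d => gdown F d b z)).
by apply: eq_bigr => d _; rewrite delta_y_vert.
Qed.

(** The coordinate field d/dx^e is not horizontal: delta y^d takes the value G^d_e on it, hence the
    cross terms. *)
Lemma sasaki_matsumoto_vert_hor z a e :
  sasaki_matsumoto F z (basis_vec (rshift n a)) (basis_vec (lshift n e)) =
  \sum_d gdown F a d z * spray1 F d e z.
Proof.
rewrite sasaki_matsumoto_horr big1 ?add0r => [|b _]; last by rewrite basisE eq_lrshift mulr0.
rewrite -[RHS](pick_sum (fun b => \sum_d gdown F b d z * spray1 F d e z)).
apply: eq_bigr => b _; rewrite mulr_suml; apply: eq_bigr => d _.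
by rewrite delta_y_vert mulrAC.
Qed.

Lemma sasaki_matsumoto_sym z X Y :
  (forall a b, gdown F a b z = gdown F b a z) ->
  sasaki_matsumoto F z X Y = sasaki_matsumoto F z Y X.
Proof.
move=> gS; rewrite /sasaki_matsumoto; congr (_ + _); rewrite exchange_big /=;
  by apply: eq_bigr => a _; apply: eq_bigr => b _; rewrite gS mulrAC.
Qed.

(* The horizontal components of [X] are recovered by pairing [X] with the
   horizontal lifts delta/delta x^e. *)
Lemma sasaki_matsumoto_delta z X e :
  sasaki_matsumoto F z X (basis_vec (lshift n e)) -
  \sum_d spray1 F d e z * sasaki_matsumoto F z X (basis_vec (rshift n d)) =
  \sum_a gdown F a e z * X 0 (lshift n a).
Proof.
rewrite sasaki_matsumoto_horr -addrA -[RHS]addr0; congr (_ + _).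
apply/eqP; rewrite subr_eq0 exchange_big; apply/eqP => /=; apply: eq_bigr => d _.
by rewrite sasaki_matsumoto_vertr mulr_sumr; apply: eq_bigr => a _; rewrite mulrC.
Qed.
End SasakiMatsumoto.

(** * Covariant derivatives of vertical coordinate fields *)

Lemma partial_sum {R : realType} {m : nat} {I : Type} (s : seq I)
    (f : I -> 'rV[R]_m -> R) A z :
  (forall i, differentiable (f i) z) ->
  partial A (fun t => \sum_(i <- s) f i t) z = \sum_(i <- s) partial A (f i) z.
Proof.
move=> df.
suff [] : differentiable (fun t => \sum_(i <- s) f i t) z /\
    partial A (fun t => \sum_(i <- s) f i t) z = \sum_(i <- s) partial A (f i) z by [].
elim: s => [|i s [ds IH]].
  under eq_fun do rewrite big_nil.
  by rewrite big_nil partial_cst; split=> //; exact: differentiable_cst.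
under eq_fun do rewrite big_cons.
by rewrite big_cons partialD// IH; split=> //; exact: differentiableD.
Qed.

(** The cancellation behind [koszul_vertical]: A and A' are fibre derivatives of g, s is G^d_e, B
    and B' are entries of g, P and P' are values of G^d_ea and G^d_eb. The terms in A and A' cancel,
    and x minus the sum of s Q is the delta derivative of g_ab. *)
Lemma koszul_rearrange {R : comRingType} {n : nat} (A A' B B' P P' s Q : 'I_n -> R) x :
  \sum_d (A d * s d + B d * P d) + \sum_d (A' d * s d + B' d * P' d) - x -
    \sum_d s d * (A d + A' d - Q d) =
  \sum_d B d * P d + \sum_d B' d * P' d - (x - \sum_d s d * Q d).
Proof.
have E d : s d * (A d + A' d - Q d) = A d * s d + A' d * s d - s d * Q d by ring.
by rewrite (eq_bigr _ (fun d _ => E d)) sumrB !big_split /=; ring.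
Qed.

(** The lift delta/delta x^e is not a constant field. Koszul's formula is therefore applied with
    d/dx^e ([Kh]) and with each d/dy^d ([Kv]), and the pairing with the lift is assembled at z by
    [sasaki_matsumoto_delta]. *)
Lemma koszul_vertical {R : realType} {n : nat} {F : 'rV[R]_(n + n) -> R}
    {W : set 'rV[R]_(n + n)} {D} a b e z :
  open W -> smooth_on W (Fsq F) ->
  (forall z, W z -> (\matrix_(a, b) gdown F a b z) \in unitmx) ->
  levi_civita W (sasaki_matsumoto F) D -> W z ->
  2 * \sum_c gdown F c e z *
    D (fun=> basis_vec (rshift n a)) (fun=> basis_vec (rshift n b)) z 0 (lshift n c) =
  \sum_c gdown F b c z * spray2 F c e a z + \sum_c gdown F a c z * spray2 F c e b z
    - delta F e (gdown F a b) z.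
Proof.
move=> oW sF uF lc Wz.
have symS : forall U V, sasaki_matsumoto F z U V = sasaki_matsumoto F z V U.
  by move=> U V; apply: sasaki_matsumoto_sym => *; exact: gdown_sym Wz.
have vv p q : (fun t => sasaki_matsumoto F t (basis_vec (rshift n p)) (basis_vec (rshift n q)))
    = gdown F p q.
  by apply/funext => t; exact: sasaki_matsumoto_vert_vert.
have vh q : (fun t => sasaki_matsumoto F t (basis_vec (rshift n q)) (basis_vec (lshift n e)))
    = (fun t => \sum_d gdown F q d t * spray1 F d e t).
  by apply/funext => t; exact: sasaki_matsumoto_vert_hor.
have dvh p q : dy p (fun t => \sum_d gdown F q d t * spray1 F d e t) z
    = \sum_d (dy p (gdown F q d) z * spray1 F d e z + gdown F q d z * spray2 F d e p z).
  have dg d := smooth_on_differentiable _ _ (smooth_gdown oW sF q d) Wz.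
  have ds d := smooth_on_differentiable _ _ (smooth_spray1 oW sF uF d e) Wz.
  rewrite /dy partial_sum => [|d]; last exact: differentiableM.
  by apply: eq_bigr => d _; rewrite partialM.
set V := D _ _ z.
have Kh : 2 * sasaki_matsumoto F z V (basis_vec (lshift n e)) =
    dy a (fun t => \sum_d gdown F b d t * spray1 F d e t) z
    + dy b (fun t => \sum_d gdown F a d t * spray1 F d e t) z - dx e (gdown F a b) z.
  by rewrite (koszul_cst _ _ _ _ lc Wz symS) (vh a) (vh b) (vv a b).
have Kv d : 2 * sasaki_matsumoto F z V (basis_vec (rshift n d)) =
    dy a (gdown F b d) z + dy b (gdown F a d) z - dy d (gdown F a b) z.
  rewrite (koszul_cst _ _ _ _ lc Wz symS).
  rewrite (vv a b) (vv a d) (vv b d); exact: erefl.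
rewrite -sasaki_matsumoto_delta mulrBr Kh mulr_sumr !dvh.
under [X in _ - X = _]eq_bigr do rewrite mulrCA Kv.
exact: koszul_rearrange.
Qed.

Lemma vertical_totally_geodesicP {R : realType} {n : nat} {F : 'rV[R]_(n + n) -> R}
    {W : set 'rV[R]_(n + n)} {D} z :
  open W -> smooth_on W (Fsq F) ->
  (forall z, W z -> (\matrix_(a, b) gdown F a b z) \in unitmx) ->
  levi_civita W (sasaki_matsumoto F) D -> W z ->
  (forall a b, vertical (D (fun=> basis_vec (rshift n a)) (fun=> basis_vec (rshift n b)) z)) <->
  (forall a b c, hconn F c a b z = spray2 F c a b z).
Proof.
move=> oW sF uF lc Wz.
have uz := uF z Wz.
have C1 c a b := spray2_sym oW sF uF c a b z Wz.
have C2 e a b := delta_gdown_sym oW sF a b e z Wz.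
have := christoffelP (\matrix_(a, b) gdown F a b z) (fun c a b => spray2 F c a b z)
  (fun e a b => delta F e (gdown F a b) z) uz C1 C2.
(* It remains to match verticality with the metric compatibility condition of [christoffelP]. *)
move=> chr; apply: iff_trans chr.
split=> [vert|met] a b.
  move=> e; apply/eqP; rewrite -subr_eq0; apply/eqP.
  have /verticalP V0 := vert a b.
  have K := koszul_vertical a b e z oW sF uF lc Wz.
  rewrite big1 ?mulr0 in K => [|c _]; last by rewrite V0 mulr0.
  apply: (etrans _ (esym K)); congr (_ + _ - _).
    by apply: eq_bigr => c _; rewrite mxE.
  by apply: eq_bigr => c _; rewrite mxE.
apply/verticalP.
have K e : \sum_c gdown F c e z *
  D (fun=> basis_vec (rshift n a)) (fun=> basis_vec (rshift n b)) z 0 (lshift n c) = 0.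
  apply: (@mulfI _ 2) => //; rewrite mulr0 (koszul_vertical a b e z oW sF uF lc Wz).
  apply/eqP; rewrite subr_eq0 -met; apply/eqP.
  by congr (_ + _); apply: eq_bigr => c _; rewrite mxE.
move=> e.
set V := D _ _ z in K *.
(* By [K] the row of horizontal components is killed by the invertible matrix g, so it is zero. *)
have := congr1 (fun M : 'rV[R]_n => M 0 e) (mulmxK uz (\row_c V 0 (lshift n c))).
rewrite [RHS]mxE => <-.
rewrite mxE big1// => c _.
rewrite [X in X * _](_ : _ = 0) ?mul0r// mxE -[RHS](K c).
by apply: eq_bigr => d _; rewrite !mxE mulrC.
Qed.

(** * Coordinate selection and the summands of a warped metric *)

(** Balls of matrices are entrywise and each entry of the image is an entry of the argument, so the
    same radius serves. *)
Lemma continuous_colsub {R : realType} {m n : nat} (g : 'I_n -> 'I_m) :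
  continuous (colsub g : 'rV[R]_m -> 'rV[R]_n).
Proof.
move=> u A /nbhs_ballP[e /= e0 eA].
apply/nbhs_ballP; exists e => //= v [_ uv]; apply: eA; split => // i j.
by apply: (le_lt_trans _ (uv i (g j))); rewrite !mxE.
Qed.

Lemma partial_comp_colsub {R : realType} {m n : nat} (g : 'I_n -> 'I_m) (f : 'rV[R]_n -> R) A z :
  differentiable f (colsub g z) ->
  partial A (fun t => f (colsub g t)) z = \sum_(k < n) (g k == A)%:R * partial k f (colsub g z).
Proof.
move=> df; apply: etrans (partial_comp_lin (mxsub id g) f A z df) _.
by apply: eq_bigr => k _; rewrite /basis_vec !mxE eqxx.
Qed.

Lemma smooth_on_comp_colsub {R : realType} {m n : nat} {W : set 'rV[R]_m} (U : set 'rV[R]_n)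
    (g : 'I_n -> 'I_m) (f : 'rV[R]_n -> R) :
  open W -> (forall z, W z -> U (colsub g z)) -> smooth_on U f ->
  smooth_on W (fun z => f (colsub g z)).
Proof.
move=> oW WU sf.
exact: (smooth_on_comp_lin W U (mxsub id g) f oW (continuous_colsub g) WU sf).
Qed.

(** A nonzero w with w M = 0 would make the quadratic form vanish at w. *)
Lemma posdef_unitmx {R : realType} {n : nat} (M : 'M[R]_n) :
  (forall w : 'rV[R]_n, w <> 0 -> 0 < \sum_a \sum_b M a b * w 0 a * w 0 b) ->
  M \in unitmx.
Proof.
move=> pM; rewrite unitmxE unitfE; apply/det0P => -[w /eqP w0 wM].
have := pM _ w0; rewrite exchange_big big1 ?ltxx//= => b _.
have := congr1 (fun v : 'rV[R]_n => v 0 b * w 0 b) wM.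
rewrite !mxE mul0r => E; apply: (etrans _ E); rewrite mulr_suml. apply: eq_bigr => a _.
by rewrite [w 0 a * _]mulrC.
Qed.

(* Fibre and base coordinates of a factor inside those of the product, for an
   embedding [g] of the coordinate indices of the factor. *)
Definition tangent_index {n N : nat} (g : 'I_n -> 'I_N) (k : 'I_(n + n)) : 'I_(N + N) :=
  match fintype.split k with inl a => lshift N (g a) | inr a => rshift N (g a) end.

Lemma tangent_index_lshift {n N : nat} (g : 'I_n -> 'I_N) (a : 'I_n) :
  tangent_index g (lshift n a) = lshift N (g a).
Proof. by rewrite /tangent_index (unsplitK (inl _ a)). Qed.

Lemma tangent_index_rshift {n N : nat} (g : 'I_n -> 'I_N) (a : 'I_n) :
  tangent_index g (rshift n a) = rshift N (g a).
Proof. by rewrite /tangent_index (unsplitK (inr _ a)). Qed.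

Lemma lsubmx_tangent {R : realType} {n N : nat} (g : 'I_n -> 'I_N) (z : 'rV[R]_(N + N)) :
  lsubmx (colsub (tangent_index g) z) = colsub g (lsubmx z).
Proof. by apply/rowP => a; rewrite !mxE tangent_index_lshift. Qed.

Lemma rsubmx_tangent {R : realType} {n N : nat} (g : 'I_n -> 'I_N) (z : 'rV[R]_(N + N)) :
  rsubmx (colsub (tangent_index g) z) = colsub g (rsubmx z).
Proof. by apply/rowP => a; rewrite !mxE tangent_index_rshift. Qed.

Section WarpedTerm.
Context {R : realType} {n k N : nat}.
Variables (W : set 'rV[R]_(N + N)) (U : set 'rV[R]_k) (V : set 'rV[R]_(n + n)).
Variables (g : 'I_n -> 'I_N) (g' : 'I_k -> 'I_N).
Variables (h : 'rV[R]_k -> R) (Q : 'rV[R]_(n + n) -> R).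
Hypotheses (oW : open W) (sh : smooth_on U h) (sQ : smooth_on V Q).
Hypothesis WU : forall z, W z -> U (colsub g' (lsubmx z)).
Hypothesis WV : forall z, W z -> V (colsub (tangent_index g) z).

(** Common shape of the two summands of F^2: h is a function on the base of one factor, selected by
    g', and Q a function on the tangent bundle of the other, selected by g. *)
Definition warped_term z : R := h (colsub g' (lsubmx z)) * Q (colsub (tangent_index g) z).

Let base_factor : (fun z : 'rV[R]_(N + N) => h (colsub g' (lsubmx z))) =
  (fun z => h (colsub (lshift N \o g') z)).
Proof. by apply/funext => z; congr h; apply/rowP => a; rewrite !mxE. Qed.

Let sbase : smooth_on W (fun z : 'rV[R]_(N + N) => h (colsub g' (lsubmx z))).
Proof.
rewrite base_factor; apply: (smooth_on_comp_colsub U) => // z Wz.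
by have := WU z Wz; congr U; apply/rowP => a; rewrite !mxE.
Qed.

Let sfib (f : 'rV[R]_(n + n) -> R) : smooth_on V f -> smooth_on W (fun z => f (colsub (tangent_index g) z)).
Proof. by move=> sf; exact: (smooth_on_comp_colsub V). Qed.

Lemma smooth_warped_term : smooth_on W warped_term.
Proof. by apply: smooth_onM => //; exact: sfib. Qed.

Let dy_base A z : W z -> dy A (fun z => h (colsub g' (lsubmx z))) z = 0.
Proof.
move=> Wz; rewrite base_factor /dy partial_comp_colsub.
  by apply: big1 => a _; rewrite /= eq_lrshift mul0r.
apply: (smooth_on_differentiable _ _ sh).
by have := WU z Wz; congr U; apply/rowP => a; rewrite !mxE.
Qed.

Let dy_fib A (f : 'rV[R]_(n + n) -> R) z : smooth_on V f -> W z ->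
  dy A (fun z => f (colsub (tangent_index g) z)) z =
  \sum_(a < n) (g a == A)%:R * dy a f (colsub (tangent_index g) z).
Proof.
move=> sf Wz; rewrite /dy partial_comp_colsub; last first.
  by apply: smooth_on_differentiable sf _; exact: WV.
rewrite big_split_ord; apply: etrans (congr2 +%R (big1 _ _ _ _) erefl) _ => [a _|].
  by rewrite tangent_index_lshift eq_lrshift mul0r.
rewrite add0r.
by apply: eq_bigr => a _; rewrite tangent_index_rshift eq_rshift.
Qed.

(** The factor h depends on base coordinates alone, so it passes through both fibre derivatives. The
    Kronecker symbols keep the fibre coordinates that belong to the factor carrying Q. *)
Lemma dy2_warped_term A B z : W z ->
  dy A (dy B warped_term) z = h (colsub g' (lsubmx z)) *
    \sum_(b < n) (g b == B)%:R * \sum_(a < n) (g a == A)%:R *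
      dy a (dy b Q) (colsub (tangent_index g) z).
Proof.
move=> Wz; pose H (z : 'rV[R]_(N + N)) := h (colsub g' (lsubmx z)).
have dyH C (f : 'rV[R]_(N + N) -> R) t : smooth_on W f -> W t ->
    dy C (fun z => H z * f z) t = H t * dy C f t.
  move=> sf Wt; rewrite /dy partialM; last 2 first.
  - exact: smooth_on_differentiable sbase Wt.
  - exact: smooth_on_differentiable sf Wt.
  by rewrite [partial _ H t]dy_base// mul0r add0r.
have E1 : {in W, dy B warped_term =1
    fun t => H t * \sum_(b < n) (g b == B)%:R * dy b Q (colsub (tangent_index g) t)}.
  move=> t; rewrite inE => Wt.
  by rewrite -dy_fib//; apply: dyH => //; exact: sfib.
have sdQ b : smooth_on V (dy b Q) by exact: smooth_on_partial.
(* [E1] is an identity on the open set W, so it may be differentiated once more. *)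
transitivity (dy A (fun t => H t * \sum_(b < n) (g b == B)%:R * dy b Q (colsub (tangent_index g) t)) z).
  by apply: (eq_on_partial _ _ _ oW E1); rewrite inE.
rewrite dyH//; last first.
  apply: smooth_on_sum => // b; apply: smooth_onM => //; first exact: smooth_on_cst.
  exact: sfib.
have dc b : differentiable (fun=> (g b == B)%:R : R) z by exact: differentiable_cst.
have df b := smooth_on_differentiable _ _ (sfib _ (sdQ b)) Wz.
congr (_ * _); rewrite {1}/dy partial_sum => [|b]; last exact: differentiableM.
apply: eq_bigr => b _; rewrite partialM// partial_cst mul0r add0r; congr (_ * _).
exact: dy_fib.
Qed.

(** Summing out the Kronecker symbols restricts w to the coordinates selected by g: the Hessian of
    the term is a single block, h times that of Q. *)
Lemma hessian_warped_term (w : 'rV[R]_N) z : W z ->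
  \sum_A \sum_B dy A (dy B warped_term) z * w 0 A * w 0 B =
  h (colsub g' (lsubmx z)) * \sum_a \sum_b dy a (dy b Q) (colsub (tangent_index g) z) *
    colsub g w 0 a * colsub g w 0 b.
Proof.
move=> Wz.
have pick (c : 'I_N -> R) a : \sum_A (g a == A)%:R * c A = c (g a).
  rewrite (bigD1 (g a))//= eqxx mul1r big1 ?addr0// => A /negbTE.
  by rewrite eq_sym => ->; rewrite mul0r.
under eq_bigr do under eq_bigr do rewrite dy2_warped_term//.
set P := fun a b => dy a (dy b Q) (colsub (tangent_index g) z).
rewrite mulr_sumr; transitivity (\sum_A \sum_B \sum_(a < n) \sum_(b < n)
    (g a == A)%:R * ((g b == B)%:R * (h (colsub g' (lsubmx z)) * (P a b * w 0 A * w 0 B)))).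
  apply: eq_bigr => A _; apply: eq_bigr => B _; rewrite exchange_big.
  rewrite mulr_sumr !mulr_suml; apply: eq_bigr => b _.
  rewrite mulrA mulr_sumr !mulr_suml; apply: eq_bigr => a _.
  by rewrite -/(P a b); ring.
under eq_bigr do rewrite exchange_big; rewrite exchange_big; apply: eq_bigr => a _ /=.
rewrite mulr_sumr.
under eq_bigr do under eq_bigr do rewrite -mulr_sumr.
under eq_bigr do rewrite -mulr_sumr.
rewrite (pick (fun A => \sum_B \sum_b (g b == B)%:R * (h (colsub g' (lsubmx z)) * (P a b * w 0 A * w 0 B)))).
rewrite exchange_big; apply: eq_bigr => b _ /=.
by rewrite (pick (fun B => h (colsub g' (lsubmx z)) * (P a b * w 0 (g a) * w 0 B))) !mxE.
Qed.
End WarpedTerm.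

(** * The doubly warped product in an induced chart *)

Lemma open_slit_domain {R : realType} {n : nat} (M : manifold R n) (i : chart M) :
  open (slit_domain i).
Proof.
have -> : slit_domain i = lsubmx @^-1` (cmap i @` cdom i) `&` rsubmx @^-1` (~` [set 0]) by [].
apply: openI; apply: open_comp.
- by move=> z _; exact: continuous_lsubmx.
- exact: cimg_open.
- by move=> z _; exact: continuous_rsubmx.
- apply: closed_openC; apply: accessible_closed_set1.
  exact/hausdorff_accessible/norm_hausdorff.
Qed.

Section DwpGeometry.
Context {R : realType} {n1 n2 : nat} {M1 : manifold R n1} {M2 : manifold R n2}.
Variables (F1 : finsler_metric M1) (F2 : finsler_metric M2).
Variables (f1 : M1 -> R) (f2 : M2 -> R).
Hypotheses (f1_smooth : smooth_fun f1) (f1_gt0 : forall p, 0 < f1 p).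
Hypotheses (f2_smooth : smooth_fun f2) (f2_gt0 : forall p, 0 < f2 p).
Variables (i : chart M1) (j : chart M2).

(** The factor 1/2 makes the Hessian literally the one in [finsler_hessian]; [twice_sq] carries the
    compensating 2. *)
Let half_sq {n} {M : manifold R n} (F : finsler_metric M) (c : chart M) t : R :=
  2^-1 * tb_local c F t ^+ 2.
Let twice_sq {n} {M : manifold R n} (f : M -> R) (c : chart M) u : R :=
  2 * f (cinv c u) ^+ 2.

Let T1 := warped_term (lshift n2) (@rshift n1 n2) (twice_sq f2 j) (half_sq F1 i).
Let T2 := warped_term (@rshift n1 n2) (lshift n2) (twice_sq f1 i) (half_sq F2 j).

Let smooth_half_sq {n} {M : manifold R n} (F : finsler_metric M) (c : chart M) :
  smooth_on (slit_domain c) (half_sq F c).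
Proof.
apply: smooth_onM; [exact: open_slit_domain|exact: smooth_on_cst|].
by under eq_fun do rewrite expr2; apply: smooth_onM;
  [exact: open_slit_domain|exact: finsler_smooth..].
Qed.

Let smooth_twice_sq {n} {M : manifold R n} (f : M -> R) (c : chart M) :
  smooth_fun f -> smooth_on (cmap c @` cdom c) (twice_sq f c).
Proof.
move=> sf; apply: smooth_onM; [exact: cimg_open|exact: smooth_on_cst|].
by under eq_fun do rewrite expr2; apply: smooth_onM; [exact: cimg_open|exact: sf..].
Qed.

Let W := @dwp_domain R n1 n2 M1 M2 i j.

Let W_fst z : W z -> slit_domain i (colsub (tangent_index (lshift n2)) z).
Proof.
by case=> x1 _ y1 _; split; rewrite ?lsubmx_tangent ?rsubmx_tangent -lsubmxEsub.
Qed.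

Let W_snd z : W z -> slit_domain j (colsub (tangent_index (@rshift n1 n2)) z).
Proof.
by case=> _ x2 _ y2; split; rewrite ?lsubmx_tangent ?rsubmx_tangent -rsubmxEsub.
Qed.

Let W_base1 z : W z -> (cmap i @` cdom i) (colsub (lshift n2) (lsubmx z)).
Proof. by case=> x1 _ _ _; rewrite -lsubmxEsub. Qed.

Let W_base2 z : W z -> (cmap j @` cdom j) (colsub (@rshift n1 n2) (lsubmx z)).
Proof. by case=> _ x2 _ _; rewrite -rsubmxEsub. Qed.

Lemma open_dwp_domain : open W.
Proof.
have -> : W = colsub (tangent_index (lshift n2)) @^-1` slit_domain i `&`
    colsub (tangent_index (@rshift n1 n2)) @^-1` slit_domain j.
  apply/seteqP; split=> z; first by move=> Wz; split; [exact: W_fst|exact: W_snd].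
  rewrite /slit_domain /= !lsubmx_tangent !rsubmx_tangent -!lsubmxEsub -!rsubmxEsub.
  by case=> -[x1 y1] [x2 y2]; split.
by apply: openI; apply: open_comp;
  [move=> z _; exact: continuous_colsub|exact: open_slit_domain
  |move=> z _; exact: continuous_colsub|exact: open_slit_domain].
Qed.

Lemma Fsq_dwp : Fsq (dwp_local F1 F2 f1 f2 i j) = fun z => T1 z + T2 z.
Proof.
apply/funext => z; rewrite /Fsq /dwp_local /dwp_metric sqr_sqrtr; last first.
  by rewrite addr_ge0// mulr_ge0// sqr_ge0.
have E (a b : R) : a * b = 2 * a * (2^-1 * b) by field.
rewrite /T1 /T2 /warped_term; unfold half_sq, twice_sq, tb_local.
rewrite !lsubmx_tangent !rsubmx_tangent -!lsubmxEsub -!rsubmxEsub /=.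
by congr (_ + _); exact: E.
Qed.

Let smooth_T1 : smooth_on W T1.
Proof.
exact: smooth_warped_term open_dwp_domain (smooth_twice_sq _ _ f2_smooth)
  (smooth_half_sq F1 i) W_base2 W_fst.
Qed.

Let smooth_T2 : smooth_on W T2.
Proof.
exact: smooth_warped_term open_dwp_domain (smooth_twice_sq _ _ f1_smooth)
  (smooth_half_sq F2 j) W_base1 W_snd.
Qed.

Lemma smooth_Fsq_dwp : smooth_on W (Fsq (dwp_local F1 F2 f1 f2 i j)).
Proof. by rewrite Fsq_dwp; apply: smooth_onD => //; exact: open_dwp_domain. Qed.

Let gdown_dwp A B z : W z -> gdown (dwp_local F1 F2 f1 f2 i j) A B z =
  2^-1 * (dy A (dy B T1) z + dy A (dy B T2) z).
Proof.
move=> Wz; rewrite /gdown Fsq_dwp; congr (_ * _).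
have sT1 := smooth_on_partial (rshift (n1 + n2) B) _ smooth_T1.
have sT2 := smooth_on_partial (rshift (n1 + n2) B) _ smooth_T2.
have E : {in W, dy B (fun t => T1 t + T2 t) =1 fun t => dy B T1 t + dy B T2 t}.
  move=> t; rewrite inE => Wt; apply: partialD.
    exact: smooth_on_differentiable smooth_T1 Wt.
  exact: smooth_on_differentiable smooth_T2 Wt.
transitivity (dy A (fun t => dy B T1 t + dy B T2 t) z).
  by apply: (eq_on_partial _ _ _ open_dwp_domain E); rewrite inE.
apply: partialD.
  exact: smooth_on_differentiable sT1 Wz.
exact: smooth_on_differentiable sT2 Wz.
Qed.

(** Includes w = 0, because a nonzero vector of the product may have a zero component in one
    factor. *)
Let hess_ge0 {n} {M : manifold R n} (F : finsler_metric M) (c : chart M) z (w : 'rV[R]_n) :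
  slit_domain c z ->
  0 <= \sum_a \sum_b dy a (dy b (half_sq F c)) z * w 0 a * w 0 b.
Proof.
move=> cz; have [->|/eqP w0] := eqVneq w 0; last exact/ltW/finsler_hessian.
by rewrite big1// => a _; rewrite big1// => b _; rewrite !mxE mulr0.
Qed.

(** The quadratic form of g splits into the forms of the two factors, each with a positive weight.
    Both are nonnegative, and one is positive since a nonzero w has a nonzero component in some
    factor. *)
Lemma gdown_dwp_unitmx z : W z ->
  \matrix_(A, B) gdown (dwp_local F1 F2 f1 f2 i j) A B z \in unitmx.
Proof.
move=> Wz; apply: posdef_unitmx => w w0.
have E (p q r s : R) : 2^-1 * (p + q) * r * s = 2^-1 * (p * r * s + q * r * s) by ring.
have -> : \sum_A \sum_B (\matrix_(A, B) gdown (dwp_local F1 F2 f1 f2 i j) A B z) A B * w 0 A * w 0 B =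
    2^-1 * (\sum_A \sum_B dy A (dy B T1) z * w 0 A * w 0 B +
            \sum_A \sum_B dy A (dy B T2) z * w 0 A * w 0 B).
  rewrite -big_split mulr_sumr; apply: eq_bigr => A _.
  rewrite -big_split mulr_sumr; apply: eq_bigr => B _.
  by rewrite mxE gdown_dwp//; exact: E.
have H1 := hessian_warped_term _ _ _ _ _ _ _ open_dwp_domain
  (smooth_twice_sq _ j f2_smooth) (smooth_half_sq F1 i) W_base2 W_fst w z Wz.
have H2 := hessian_warped_term _ _ _ _ _ _ _ open_dwp_domain
  (smooth_twice_sq _ i f1_smooth) (smooth_half_sq F2 j) W_base1 W_snd w z Wz.
apply: mulr_gt0; first by rewrite invr_gt0.
rewrite [X in X + _]H1 [X in _ + X]H2.
have tw_gt0 n (M : manifold R n) (f : M -> R) (c : chart M) u : (forall p, 0 < f p) -> 0 < twice_sq f c u.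
  by move=> f0; rewrite mulr_gt0// exprn_gt0.
have [w1|/eqP w1] := eqVneq (colsub (lshift n2) w) 0.
  have w2 : colsub (@rshift n1 n2) w <> 0.
    move=> w2; apply: w0; rewrite -[w]hsubmxK lsubmxEsub rsubmxEsub w1 w2.
    exact: row_mx0.
  apply: ltr_wpDl; first by rewrite mulr_ge0 ?(ltW (tw_gt0 _ _ _ _ _ _))//; exact/hess_ge0/W_fst.
  by rewrite mulr_gt0 ?tw_gt0//; apply: finsler_hessian w2; exact: W_snd.
apply: ltr_pwDl; last by rewrite mulr_ge0 ?(ltW (tw_gt0 _ _ _ _ _ _))//; exact/hess_ge0/W_snd.
by rewrite mulr_gt0 ?tw_gt0//; apply: finsler_hessian w1; exact: W_fst.
Qed.
End DwpGeometry.

Theorem proposition3 (R : realType) (n1 n2 : nat)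
  (M1 : manifold R n1) (M2 : manifold R n2)
  (F1 : finsler_metric M1) (F2 : finsler_metric M2)
  (f1 : M1 -> R) (f2 : M2 -> R)
  (f1_smooth : smooth_fun f1) (f1_gt0 : forall p, 0 < f1 p)
  (f2_smooth : smooth_fun f2) (f2_gt0 : forall p, 0 < f2 p)
  (nabla : @dwp_connection R n1 n2 M1 M2)
  (nablaP : dwp_levi_civita F1 F2 f1 f2 nabla) :
  vertical_totally_geodesic nabla <->
  (forall (i : chart M1) (j : chart M2) (a b c : 'I_(n1 + n2)) z,
     dwp_domain i j z ->
     hconn (dwp_local F1 F2 f1 f2 i j) c a b z =
     spray2 (dwp_local F1 F2 f1 f2 i j) c a b z).
Proof.
(* The equivalence already holds at each point of each induced chart; both directions only quantify
   over it. *)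
have chartP i j z (Wz : dwp_domain i j z) := vertical_totally_geodesicP z
  (open_dwp_domain i j) (smooth_Fsq_dwp F1 F2 f1 f2 f1_smooth f2_smooth i j)
  (gdown_dwp_unitmx F1 F2 f1 f2 f1_smooth f1_gt0 f2_smooth f2_gt0 i j) (nablaP i j) Wz.
split=> [vert i j a b c z Wz|FG i j a b z Wz].
  by apply: (chartP i j z Wz).1 => a' b'; exact: vert.
by apply: (chartP i j z Wz).2 => a' b' c; exact: FG.
Qed.
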